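(* Let $\kappa$ be a regular uncountable cardinal and suppose that $\langle\mathcal C_\alpha\mid\alpha<\kappa\rangle$ is a $\square(\kappa,{<}\omega)$-sequence. Then for every stationary $\Gamma\subseteq\kappa$ there exists a $\square(\kappa,{<}\omega)$-sequence $\langle\mathcal C^\bullet_\alpha\mid\alpha<\kappa\rangle$ such that: (1) $|\mathcal C^\bullet_\alpha|\le|\mathcal C_\alpha|$ for all $\alpha<\kappa$; (2) for every $i<\kappa$, the set $\{\alpha\in\Gamma\mid\forall C\in\mathcal C^\bullet_\alpha\,[\min(C)=i]\}$ is stationary.
   Context: A $\square(\kappa,{<}\omega)$-sequence is a sequence $\langle\mathcal C_\alpha\mid\alpha<\kappa\rangle$ such that: $\mathcal C_0=\{\emptyset\}$, $\mathcal C_{\beta+1}=\{\{\beta\}\}$, and for every limit $\alpha<\kappa$, $\mathcal C_\alpha$ is a nonempty finite collection of clubs in $\alpha$; for every $\alpha<\kappa$, every $C\in\mathcal C_\alpha$ and every accumulation point $\bar\alpha<\alpha$ of $C$, $C\cap\bar\alpha\in\mathcal C_{\bar\alpha}$; and there is no club $D\subseteq\kappa$ such that $D\cap\alpha\in\mathcal C_\alpha$ for every accumulation point $\alpha<\kappa$ of $D$. *)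

(* Defs.v *)
From mathcomp Require Import all_boot all_order interval.
From mathcomp Require Import all_classical wochoice.

Set Implicit Arguments.
Unset Strict Implicit.
Unset Printing Implicit Defensive.

Import Order.TTheory.
Local Open Scope card_scope.
Local Open Scope order_scope.
Local Open Scope classical_set_scope.

(* A cardinal kappa is represented by a well-ordered type K whose order type is
   kappa: an ordinal below kappa is an element a of K, and its set of elements
   is the initial segment `]-oo, a[. *)

Section RegularCardinals.
Context {d : Order.disp_t} (K : orderType d).

(* No proper initial segment is equipotent to the whole of K. *)
Definition initial_ordinal : Prop :=
  well_order (<=%O : rel K) /\
  forall a : K, ~~ ([set: K] #<= `]-oo, a[).

Definition cofinal (A : set K) : Prop :=
  forall a : K, exists2 b, A b & a <= b.

Definition regular_uncountable : Prop :=
  [/\ initial_ordinal,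
      forall A : set K, cofinal A -> [set: K] #<= A &
      ~ countable [set: K]].

End RegularCardinals.

Section Clubs.
Context {d : Order.disp_t} {K : orderType d}.
Implicit Types (a b i : K) (A C D G I : set K).

Definition is_zero a : Prop := `]-oo, a[ = set0 :> set K.

(* b = a + 1, that is b = a `|` {a} *)
Definition is_succ a b : Prop := `]-oo, b[ = `]-oo, a] :> set K.

Definition is_limit a : Prop := ~ is_zero a /\ ~ exists b, is_succ b a.

(* sup (A `&` a) = a > 0 *)
Definition acc A a : Prop :=
  ~ is_zero a /\ forall b, b < a -> exists2 c, A c & b < c < a.

(* C is closed and unbounded in I, which is meant to be a limit ordinal
   `]-oo, a[ or the whole of kappa, [set: K]. *)
Definition club_in I C : Prop :=
  [/\ C `<=` I,
      forall b, I b -> exists2 c, C c & b <= c &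
      forall a, I a -> acc C a -> C a].

Definition stationary G : Prop :=
  forall D, club_in [set: K] D -> G `&` D !=set0.

Definition square_fin (CC : K -> set (set K)) : Prop :=
  [/\ forall a, is_zero a -> CC a = [set set0],
      forall b a, is_succ b a -> CC a = [set [set b]],
      forall a, is_limit a ->
        [/\ CC a !=set0, finite_set (CC a) &
            forall C, CC a C -> club_in `]-oo, a[ C],
      forall a C, CC a C -> forall b, b < a -> acc C b ->
        CC b (C `&` `]-oo, b[) &
      ~ exists D, club_in [set: K] D /\
          forall a, acc D a -> CC a (D `&` `]-oo, a[)].

Definition is_min C i : Prop := C i /\ lbound C i.

End Clubs.

(* Main.v *)
Require Import Defs.
From mathcomp Require Import all_boot all_order interval.
From mathcomp Require Import all_classical wochoice.

Local Open Scope card_scope.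
Local Open Scope classical_set_scope.

(* Write Phi C for C with its elements up to t replaced by h t, where t is the
   first element of C above e and h is regressive.  Phi commutes with taking
   initial segments at accumulation points of Phi C, so the sets Phi C form a
   coherent sequence; a thread through it lifts to a thread through CC, because
   a coherent system of finite nonempty sets has a branch.
   It remains to choose e and h.  By Fodor, it is enough that for every u there
   are stationarily many a in Gamma all of whose clubs avoid (e, u): then, for
   i < kappa, there are disjoint intervals [b_i, u_i] containing, for
   stationarily many a in Gamma, the first elements above e of all the clubs of
   CC a, and h takes the value i on [b_i, u_i].  If no such e existed, finitely
   many clubs of CC a would meet all the intervals (e, f e), e < a, for some f
   and club many a in Gamma; taking the number of clubs needed to be least
   yields a thread through CC. *)

Set Implicit Arguments.
Unset Strict Implicit.
Unset Printing Implicit Defensive.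

Import Order.TTheory.
Local Open Scope order_scope.
Local Open Scope classical_set_scope.

(** * Accumulation points, closure points of functions, stationarity *)

Section Accumulation.
Context {d : Order.disp_t} {K : orderType d}.
Implicit Types (a b c s : K) (A C D E : set K) (f : K -> K).

Lemma in_init a : `]-oo, a[%classic = [set x : K | x < a].
Proof. by rewrite set_itvE. Qed.

Lemma init_neq0 s : (~ is_zero s) <-> exists a, a < s.
Proof.
rewrite /is_zero in_init; split=> [/eqP/set0P[a]|[a a_s] s0]; first by exists a.
by have : [set x : K | x < s] a by []; rewrite s0.
Qed.

Lemma zero_le {a} (z : is_zero a) b : a <= b.
Proof. by rewrite leNgt; apply/negP => ba; apply/init_neq0: z; exists b. Qed.

Lemma limit_intro s :
  ~ is_zero s -> (forall a, a < s -> exists2 b, a < b & b < s) -> is_limit s.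
Proof.
move=> s0 sl; split=> // -[b]; rewrite /is_succ !set_itvE => /seteqP[h1 h2].
have /sl[c bc /h1 /=] : b < s by apply: h2 => /=.
by rewrite leNgt bc.
Qed.

Lemma acc_limit {A a} : acc A a -> is_limit a.
Proof.
by move=> [a0 aA]; apply: limit_intro => // b /aA[c _ /andP[]]; exists c.
Qed.

Lemma accS {A B} a : (forall x, x < a -> A x -> B x) -> acc A a -> acc B a.
Proof.
move=> AB [a0 aA]; split=> // b /aA[c Ac /andP[bc ca]]; exists c; last exact/andP.
exact: AB.
Qed.

Lemma acc_restr A a b : b <= a -> acc (A `&` `]-oo, a[) b <-> acc A b.
Proof.
move=> ba; split; apply: accS => x xb; first by case.
by move=> Ax; split=> //; rewrite in_init /=; exact: lt_le_trans ba.
Qed.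

Lemma restr_restr A a b : b <= a ->
  (A `&` `]-oo, a[) `&` `]-oo, b[ = A `&` `]-oo, b[ :> set K.
Proof.
move=> ba; rewrite !in_init; apply/seteqP; split=> x /= [].
  by case.
by move=> Ax xb; split=> //; split=> //; exact: lt_le_trans ba.
Qed.

Definition closed_under f s := ~ is_zero s /\ forall a, a < s -> f a < s.

Lemma closed_under_le f g s :
  (forall a, f a <= g a) -> closed_under g s -> closed_under f s.
Proof.
by move=> fg [s0 gs]; split=> // a /gs; exact: le_lt_trans.
Qed.

Lemma closed_under_max f g s : closed_under (fun a => Order.max (f a) (g a)) s ->
  closed_under f s /\ closed_under g s.
Proof.
by move=> h; split; apply: closed_under_le h => a; rewrite le_max lexx ?orbT.
Qed.

Lemma closed_under_limit f s :
  (forall a, a < f a) -> closed_under f s -> is_limit s.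
Proof.
by move=> af [s0 fs]; apply: limit_intro => // a /fs; exists (f a).
Qed.

(** For regular uncountable [K] the sets of closure points of functions generate the club filter, so
    this is stationarity ([stationaryE]). Intersecting clubs becomes taking maxima of functions. *)
Definition stat (S : set K) := forall f, exists2 s, S s & closed_under f s.

Lemma statS (S T : set K) : S `<=` T -> stat S -> stat T.
Proof. by move=> ST sS f; have [s /ST] := sS f; exists s. Qed.

Lemma statI_closed (S : set K) f :
  stat S -> stat [set s | S s /\ closed_under f s].
Proof.
move=> sS g; have [s Ss] := sS (fun a => Order.max (f a) (g a)).
by move=> /closed_under_max[]; exists s.
Qed.

Lemma not_stat (S : set K) :
  ~ stat S -> exists f, forall s, closed_under f s -> ~ S s.
Proof.
by move=> /existsNP[f nf]; exists f => s fs Ss; apply: nf; exists s.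
Qed.

End Accumulation.

(** * Bounds from regularity, closure points, pressing down *)

Section Regular.
Context {d : Order.disp_t} {K : orderType d}.
Hypothesis hK : regular_uncountable K.
Implicit Types (a b c s : K) (A C D E : set K) (f g : K -> K).

Lemma least A : A !=set0 -> exists2 a, A a & lbound A a.
Proof.
case: hK => -[wo _] _ _ [x Ax].
have [|z [[/set_mem Az zmin] _]] := wo (mem A); first by exists x; exact/mem_set.
by exists z => // y Ay; apply: zmin; exact/mem_set.
Qed.

Lemma lt_wf : well_founded (fun a b : K => a < b).
Proof.
move=> a; apply: contrapT => na.
have [b nb bmin] := least (ex_intro _ a na : [set a | ~ Acc _ a] !=set0).
apply: nb; constructor => c cb; apply: contrapT => nc.
by have := bmin _ nc; rewrite leNgt cb.
Qed.

Lemma small_bounded A : ~ ([set: K] #<= A) -> exists u, forall a, A a -> a < u.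
Proof.
case: hK => _ reg _ nA; apply: contrapT => nu; apply: nA; apply: reg => a.
apply: contrapT => na; apply: nu; exists a => b Ab; rewrite ltNge; apply/negP => ab.
by apply: na; exists b.
Qed.

Lemma countable_bounded (F : nat -> K) : exists u, forall n, F n < u.
Proof.
have [|u uF] := @small_bounded (range F); last first.
  by exists u => n; apply: uF; exists n.
case: hK => _ _ nc KF; apply: nc; apply: sub_countable KF _.
exact: (sub_countable (card_image_le _ _)).
Qed.

Lemma exists_succ : exists f, forall a, a < f a.
Proof.
have /choice[f fP] : forall a, exists b, a < b.
  by move=> a; have [b /(_ 0%N)] := countable_bounded (fun=> a); exists b.
by exists f.
Qed.

Lemma init_bounded f a : exists u, forall b, b < a -> f b < u.
Proof.
have [|u uF] := @small_bounded (f @` [set b | b < a]); last first.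
  by exists u => n na; apply: uF; exists n.
case: hK => -[_ /(_ a) + _ _ h]; rewrite in_init => /negP; apply.
exact: card_le_trans h (card_image_le _ _).
Qed.

Lemma init_closed_bounded f a : exists u, forall b, b <= a -> f b < u.
Proof.
have [sc scP] := exists_succ; have [u uP] := init_bounded f (sc a).
by exists u => b ba; apply: uP; exact: le_lt_trans (scP a).
Qed.

Lemma closed_under_all (F : nat -> K -> K) :
  exists g, forall s, closed_under g s -> forall n, closed_under (F n) s.
Proof.
have /choice[g gP] a := countable_bounded (F^~ a).
exists g => s gs n; apply: closed_under_le gs => a; exact: ltW.
Qed.

(** Diagonal intersection of clubs: with [c = max a b], the proof arranges [F b a < h b c < g c]. *)
Lemma closed_under_diag (F : K -> K -> K) :
  exists g, forall s, closed_under g s -> forall b, b < s -> closed_under (F b) s.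
Proof.
have /choice[h hP] : forall b, exists h : K -> K, forall c a, a <= c -> F b a < h c.
  by move=> b; have /choice[h hP] := init_closed_bounded (F b); exists h.
have /choice[g gP] c := init_closed_bounded (h^~ c) c.
exists g => s [s0 gs] b bs; split=> // a as_.
have cs : Order.max a b < s by rewrite gt_max as_ bs.
apply: lt_trans (gs _ cs); apply: lt_trans (gP (Order.max a b) b _).
  by apply: hP; rewrite le_max lexx.
by rewrite le_max lexx orbT.
Qed.

Lemma closed_under_unbounded f a : exists2 s, a < s & closed_under f s.
Proof.
have [sc scP] := exists_succ.
have /choice[g gP] c := init_closed_bounded (fun x => Order.max (f x) (sc x)) c.
pose x n := iter n g a.
(* [s] is the limit of the iterates: any [b < s] is below some [x n], whence [f b < x n.+1 < s]. *)
have [s sx smin] := least (countable_bounded x : [set u | _] !=set0).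
have hs b : b < s -> exists n, b <= x n.
  move=> bs; apply: contrapT => /forallNP nb.
  suff /smin : forall n, x n < b by rewrite leNgt bs.
  by move=> n; rewrite ltNge; apply/negP/nb.
exists s; first exact: (sx 0%N).
split; first by apply/init_neq0; exists a; exact: (sx 0%N).
move=> b /hs[n bn]; apply: le_lt_trans (sx n.+1); rewrite /x iterS.
by have := gP _ _ bn; rewrite gt_max => /andP[/ltW].
Qed.

Lemma club_acc_closed D :
  club_in [set: K] D -> exists f, forall s, closed_under f s -> acc D s.
Proof.
move=> [_ Du _]; have [sc scP] := exists_succ.
have /choice[f fP] a : exists b, D b /\ a < b.
  by have [//|b Db ab] := Du (sc a); exists b; split=> //; exact: lt_le_trans ab.
exists f => s [s0 fs]; split=> // b bs.
by have [Db bf] := fP b; exists (f b) => //; rewrite bf fs.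
Qed.

Lemma acc_unbounded D : club_in [set: K] D -> forall a, exists2 s, acc D s & a < s.
Proof.
move=> /club_acc_closed[f fD] a.
by have [s as_ /fD sD] := closed_under_unbounded f a; exists s.
Qed.

Lemma stationaryE (S : set K) : stationary S <-> stat S.
Proof.
have [sc scP] := exists_succ; split=> [statS f|statS D cD]; last first.
  have [f fD] := club_acc_closed cD; have [s Ss /fD sD] := statS f.
  by exists s; split=> //; case: cD => _ _; apply.
pose g a := Order.max (f a) (sc a).
have [|s [Ss /closed_under_max[]]] := statS (closed_under g); last by exists s.
split=> // [b _|s _ [s0 sg]].
  by have [s bs gs] := closed_under_unbounded g b; exists s => //; exact: ltW.
by split=> // a /sg[c [_ gc] /andP[ac cs]]; exact: lt_trans (gc _ ac) cs.
Qed.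

Lemma stat_bigcup_nat (S : nat -> set K) :
  stat (\bigcup_n S n) -> exists n, stat (S n).
Proof.
move=> sS; apply: contrapT => /forallNP nS.
have /choice[F FP] n := not_stat (nS n).
have [g gP] := closed_under_all F; have [s [n _ Sn] /gP gs] := sS g.
exact: FP _ _ (gs n) Sn.
Qed.

(** Pressing down, with the regressive choice given as a relation. If closure points of [F b]
    avoided [S b] for each [b], a point [s] of the diagonal intersection would lie in no [S b] with
    [b < s]. *)
Lemma fodor (S : K -> set K) :
  stat [set s | exists2 b, b < s & S b s] -> exists b, stat (S b).
Proof.
move=> sS; apply: contrapT => /forallNP nS.
have /choice[F FP] b := not_stat (nS b).
have [g gP] := closed_under_diag F; have [s [b bs Sb] /gP gs] := sS g.
exact: FP _ _ (gs _ bs) Sb.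
Qed.

(* An ultrafilter on A containing all the tails of A selects, from a choice of
   one C in each T a, a coherent branch. *)
Lemma finite_coherent_branch A (T : K -> set (set K)) :
  (forall a, exists2 b, A b & a < b) ->
  (forall a, A a -> finite_set (T a) /\ T a !=set0) ->
  (forall a b C, A a -> A b -> b < a -> T a C -> T b (C `&` `]-oo, b[)) ->
  exists E : set K, forall a, A a -> T a (E `&` `]-oo, a[).
Proof.
move=> Aunb Tfin Tcoh.
have /choice[c cP] a : exists C, A a -> T a C.
  have [Aa|] := pselect (A a); last by exists set0.
  by have [_ [C TC]] := Tfin a Aa; exists C.
pose B a := [set b | A b /\ a < b].
have FF : Filter (filter_from setT B).
  apply: filter_fromT_filter.
    case: hK => _ _ nc; apply: contrapT => nK; apply: nc.
    by rewrite (_ : setT = set0)//; apply/seteqP; split=> // x; case: nK; exists x.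
  move=> a b; exists (Order.max a b) => x [Ax].
  by rewrite gt_max => /andP[].
have PF : ProperFilter (filter_from setT B).
  by apply: filter_from_proper => a _; have [b] := Aunb a; exists b.
have [U [UU BU]] := ultraFilterLemma PF.
exists [set x | U [set b | c b x]] => a Aa.
have Ba : U (B a) by apply: BU; exists a.
(* For [b] in [A] above [a] the trace of [c b] on [a] lies in the finite set [T a], so [U]
   concentrates on a single value. *)
have [C [TC UC]] : exists C, T a C /\ U [set b | c b `&` `]-oo, a[ = C].
  apply: contrapT => nC.
  have [+ _] := Tfin a Aa => /finite_seqP[s Ts].
  have : U [set b | forall C, C \in s -> c b `&` `]-oo, a[ <> C].
    have : forall C, C \in s -> T a C by move=> C; rewrite Ts.
    elim: s {Ts} => [_|C s IH sT].
      by apply: filterS filterT => b _ C; rewrite in_nil.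
    have sU : U [set b | forall C0, C0 \in s -> c b `&` `]-oo, a[ <> C0].
      by apply: IH => C' C's; apply: sT; rewrite in_cons C's orbT.
    have : U (~` [set b | c b `&` `]-oo, a[ = C]).
      have [UC|//] := in_ultra_setVsetC [set b | c b `&` `]-oo, a[ = C] UU.
      by exfalso; apply: nC; exists C; split=> //; apply: sT; rewrite mem_head.
    apply: filterS2 sU => b h1 h2 C0; rewrite in_cons => /predU1P[->//|]; exact: h1.
  move=> /(filterI Ba) /filter_ex[b [[Ab ab] /= h]].
  apply: (h (c b `&` `]-oo, a[)) => //.
  have : T a (c b `&` `]-oo, a[) by apply: (Tcoh b) => //; exact: cP.
  by rewrite Ts.
suff -> : [set x | U [set b | c b x]] `&` `]-oo, a[ = C by [].
rewrite in_init in UC *; apply/seteqP; split=> x /=.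
  by move=> [/(filterI UC) /filter_ex[b /= [<-]]].
move=> Cx; split.
  by apply: filterS UC => b /= bC; move: Cx; rewrite -bC => -[].
by have /filter_ex[b /= bC] := UC; move: Cx; rewrite -bC => -[].
Qed.

End Regular.

(** * Threads and finite covering families *)

Section SquareSequence.
Context {d : Order.disp_t} {K : orderType d}.
Hypothesis hK : regular_uncountable K.
Implicit Types (a b c e s t : K) (A C D E : set K) (f g h : K -> K).

(** A branch [E] of [T] would be a thread: any accumulation point of [E] lies below some [b] in [A],
    the trace of [E] on [b] is in [CC b], and [CC] is coherent. *)
Lemma no_coherent_system (CC : K -> set (set K)) A (T : K -> set (set K)) :
  square_fin CC ->
  (forall a, exists2 b, A b & a < b) ->
  A `<=` is_limit ->
  (forall a, A a -> T a `<=` CC a /\ T a !=set0) ->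
  ~ forall a b C, A a -> A b -> b < a -> T a C -> T b (C `&` `]-oo, b[).
Proof.
move=> [_ _ CClim CCcoh nthread] Aunb Alim TCC Tcoh; apply: nthread.
have Tfin a : A a -> finite_set (T a) /\ T a !=set0.
  move=> Aa; have [TC T0] := TCC a Aa; split=> //.
  by apply: sub_finite_set TC _; have [] := CClim a (Alim a Aa).
have [E ET] := finite_coherent_branch hK Aunb Tfin Tcoh.
have ECC a : A a -> CC a (E `&` `]-oo, a[) by move=> Aa; exact/(TCC a Aa).1/ET.
have Eclub a : A a -> club_in `]-oo, a[ (E `&` `]-oo, a[).
  by move=> Aa; have [_ _ cl] := CClim a (Alim a Aa); exact/cl/ECC.
exists E; split.
  split=> // [b _|a _ Ea].
    have [a Aa ba] := Aunb b; have [_ + _] := Eclub a Aa.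
    by rewrite in_init => /(_ b ba)[c [Ec _] bc]; exists c.
  have [b Ab ab] := Aunb a; have [_ _] := Eclub b Ab.
  rewrite {1}in_init => /(_ a ab)[]//; apply/acc_restr => //; exact: ltW.
move=> a Ea; have [b Ab ab] := Aunb a.
rewrite -(@restr_restr _ _ E b a (ltW ab)); apply: (CCcoh b) => //.
  exact: ECC.
by apply/acc_restr => //; exact: ltW.
Qed.

Lemma seq_bounded (T : eqType) (S : seq T) (R : T -> K -> Prop) s :
  ~ is_zero s ->
  (forall x, x \in S -> exists2 b, b < s & forall c, R x c -> c <= b) ->
  exists2 b, b < s & forall x c, x \in S -> R x c -> c <= b.
Proof.
move=> s0; elim: S => [_|x S IH SR]; first by have [b] := (init_neq0 s).1 s0; exists b.
have [|b bs bS] := IH; first by move=> y yS; apply: SR; rewrite in_cons yS orbT.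
have [b' b's b'x] := SR x (mem_head x S).
exists (Order.max b b') => [|y c]; first by rewrite gt_max bs.
rewrite in_cons le_max => /predU1P[-> /b'x -> | yS /(bS _ _ yS) -> //].
by rewrite orbT.
Qed.

Lemma not_acc_bounded C a : ~ is_zero a -> ~ acc C a ->
  exists2 b, b < a & forall c, C c /\ c < a -> c <= b.
Proof.
move=> a0 naC; apply: contrapT => nb; apply: naC; split=> // b ba.
apply: contrapT => nc; apply: nb; exists b => // c [Cc ca].
by rewrite leNgt; apply/negP => bc; apply: nc; exists c => //; rewrite bc.
Qed.

Definition covered (CC : K -> set (set K)) f (m : nat) b : set K :=
  [set s | exists S : seq (set K), [/\ size S = m, forall C, C \in S -> CC s C &
    forall e, b <= e -> e < s ->
      exists2 C, C \in S & exists2 c, C c & e < c < f e]].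

(** Members of [S] not accumulating at [a] are bounded below [a]. Past these bounds, the point met
    in (e, f e) is below [a] by closure under [f], so it comes from a member that does accumulate at
    [a]. *)
Lemma covered_restr (CC : K -> set (set K)) f b s a (S : seq (set K)) :
  square_fin CC -> closed_under f a -> b < a -> a < s ->
  (forall C, C \in S -> CC s C) ->
  (forall e, b <= e -> e < s ->
     exists2 C, C \in S & exists2 c, C c & e < c < f e) ->
  exists2 b', b' < a & covered CC f (count (fun C => `[< acc C a >]) S) b' a.
Proof.
move=> [_ _ _ CCcoh _] [a0 fa] ba as_ SCC Scov.
have [|b0 b0a b0S] := @seq_bounded _ S (fun C c => [/\ C c, c < a & ~ acc C a]) _ a0.
  move=> C _; have [aC|/(not_acc_bounded a0)[b' b'a b'P]] := pselect (acc C a).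
    by exists b => // c [].
  by exists b' => // c [Cc ca _]; exact: b'P.
exists (Order.max b b0); first by rewrite gt_max ba.
exists [seq C `&` `]-oo, a[ | C <- S & `[< acc C a >]]; split.
- by rewrite size_map size_filter.
- move=> _ /mapP[C + ->]; rewrite mem_filter => /andP[/asboolP Ca CS].
  exact: CCcoh (SCC _ CS) _ as_ Ca.
move=> e; rewrite ge_max => /andP[be b0e] ea.
have [C CS [c Cc /andP[ec cf]]] := Scov e be (lt_trans ea as_).
have ca : c < a by exact: lt_trans (fa _ ea).
exists (C `&` `]-oo, a[).
  apply/mapP; exists C => //; rewrite mem_filter CS andbT; apply/asboolP.
  apply: contrapT => nC; have := b0S C c CS (And3 Cc ca nC).
  by rewrite leNgt (le_lt_trans b0e ec).
by exists c; [split=> //; rewrite in_init|rewrite ec].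
Qed.

(* Otherwise, for some f and for club many s in G, finitely many members of
   CC s meet together all the intervals (e, f e), for e in a tail of s.  When
   their number m is least, each of those members accumulates at club many
   a < s, since the ones that do already cover a tail of a; hence a thread. *)
Lemma exists_gap (CC : K -> set (set K)) (G : set K) :
  square_fin CC -> stat G ->
  exists e, forall u, stat [set s | G s /\
    forall C c, CC s C -> C c -> e < c -> u <= c].
Proof.
move=> hCC sG; have [_ _ CClim CCcoh _] := hCC; have [sc scP] := exists_succ hK.
apply: contrapT => /forallNP ngap.
have /choice[f /choice[F FP]] e : exists u, exists F, forall s, closed_under F s ->
    ~ (G s /\ forall C c, CC s C -> C c -> e < c -> u <= c).
  by have /existsNP[u /not_stat[F FP]] := ngap e; exists u, F.
have [g0 g0P] := closed_under_diag hK F.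
pose cov m := [set s | exists2 b, b < s & covered CC f m b s].
(* All of [CC s] serves as the covering family when [s] is closed under every [F e] with [e < s].
   Its size depends on [s] and is fixed by countable completeness. *)
have [m0 sm0] : exists m, stat (cov m).
  apply: (stat_bigcup_nat hK).
  apply: statS (statI_closed (fun a => Order.max (g0 a) (sc a)) sG).
  move=> s [Gs /closed_under_max[g0s scs]].
  have [_ + _] := CClim s (closed_under_limit scP scs) => /finite_seqP[S CCS].
  have [b bs] := (init_neq0 s).1 scs.1.
  exists (size S) => //; exists b => //; exists S; split=> // [C|e _ es].
    by rewrite CCS.
  apply: contrapT => nS; apply: (FP e s (g0P s g0s e es)); split=> // C c CC_C Cc ec.
  rewrite leNgt; apply/negP => cf; apply: nS; exists C.
    by move: CC_C; rewrite CCS.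
  by exists c => //; rewrite ec.
have exm : exists m, `[< stat (cov m) >] by exists m0; apply/asboolP.
case: (ex_minnP exm) => m /asboolP sm mmin {m0 sm0 exm}.
have /choice[H HP] n : exists H, forall s, closed_under H s -> (n < m)%N -> ~ cov n s.
  have [nm|nm] := ltnP n m; last by exists id.
  have [/asboolP/mmin|/not_stat[H HP]] := pselect (stat (cov n)).
    by rewrite leqNgt nm.
  by exists H => s /HP.
have [g1 g1P] := closed_under_all hK H.
have [b sW] := fodor hK sm.
pose g a := Order.max (Order.max (g1 a) (f a)) (sc a).
pose A := [set s | closed_under g s /\ b < s].
(* Were some member of [S] not to accumulate at [a], fewer than [m] sets would cover a tail of [a],
   which closure under all the [H n] forbids. *)
have acc_covering s S a : size S = m -> (forall C, C \in S -> CC s C) ->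
    (forall e, b <= e -> e < s ->
       exists2 C, C \in S & exists2 c, C c & e < c < f e) ->
    A a -> a < s -> forall C, C \in S -> acc C a.
  move=> Sm SCC Scov [/closed_under_max[/closed_under_max[g1a fa] sca] ba] as_ C CS.
  have cova := covered_restr hCC fa ba as_ SCC Scov.
  apply: contrapT => nCa; apply: HP cova; first exact: g1P.
  rewrite -Sm ltn_neqAle count_size andbT -all_count.
  by apply/allPn; exists C => //; apply/asboolP.
(* Asking for accumulation at every earlier point of [A] makes the system coherent; only
   nonemptiness needs the covering families. *)
apply: (@no_coherent_system CC A
  (fun s => [set C | CC s C /\ forall a, A a -> a < s -> acc C a]) hCC).
- move=> a; have [s abs gs] := closed_under_unbounded hK g (Order.max a b).
  by move: abs; rewrite gt_max => /andP[as_ bs]; exists s.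
- by move=> s [/closed_under_max[_ scs] _]; exact: closed_under_limit scs.
- move=> s As; split; first by move=> C [].
  (* Closure under the constant function [s] gives a covered [t] above [s]; a covering member at [t]
     is then cut down to [s]. *)
  have [t [S [Sm SCC Scov]] [t0 tP]] := sW (fun=> s).
  have st : s < t by have [c /tP] := (init_neq0 t).1 t0.
  have [C CS _] := Scov b (lexx b) (lt_trans As.2 st).
  exists (C `&` `]-oo, s[); split.
    by apply: CCcoh (SCC C CS) _ (st) _; exact: acc_covering Scov As st _ CS.
  move=> a Aa as_; apply/acc_restr; first exact: ltW.
  exact: acc_covering Scov Aa (lt_trans as_ st) _ CS.
- move=> a c C Aa Ac ca [CC_C Cacc]; split.
    by apply: CCcoh CC_C _ (ca) _; exact: Cacc.
  move=> a' Aa' a'c; apply/acc_restr; first exact: ltW.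
  by apply: Cacc => //; exact: lt_trans ca.
Qed.

(** * Replacing the first element above [e] *)

Definition first_above e C t := [/\ C t, e < t & forall c, C c -> e < c -> t <= c].

Lemma first_above_or_le e C :
  (exists t, first_above e C t) \/ (forall c, C c -> c <= e).
Proof.
have [[c [Cc ec]]|nc] := pselect (exists c, C c /\ e < c); last first.
  by right=> c Cc; rewrite leNgt; apply/negP => ec; apply: nc; exists c.
have [t [Ct et] tmin] := least hK (ex_intro _ c (conj Cc ec) : C `&` (> e) !=set0).
by left; exists t; split=> // b Cb eb; exact: tmin.
Qed.

Lemma first_above_inj e C t t' : first_above e C t -> first_above e C t' -> t = t'.
Proof. by move=> [Ct et tm] [Ct' et' tm']; apply/le_anti; rewrite tm ?tm'. Qed.

Lemma first_above_restr e C t a :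
  t < a -> first_above e C t -> first_above e (C `&` `]-oo, a[) t.
Proof.
by move=> ta [Ct et tm]; split=> // c [Cc _]; exact: tm.
Qed.

(** This is Phi. The second disjunct leaves [C] alone when nothing in it exceeds [e], as for clubs
    in limits up to [e]. *)
Definition replace_first e h C : set K :=
  [set x | (exists2 t, first_above e C t & x = h t \/ C x /\ t < x) \/
           (forall c, C c -> c <= e) /\ C x].

Lemma replace_firstE e h C t : first_above e C t ->
  replace_first e h C = [set x | x = h t \/ C x /\ t < x].
Proof.
move=> Ct; apply/seteqP; split=> x; last by left; exists t.
case=> [[t' /(first_above_inj Ct) <-]//|[Ce _]].
by case: Ct => /Ce; rewrite leNgt => /negP.
Qed.

Lemma replace_first_id e h C :
  (forall c, C c -> c <= e) -> replace_first e h C = C.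
Proof.
move=> Ce; apply/seteqP; split=> x; last by right.
by case=> [[t [/Ce]]|[]//]; rewrite leNgt => /negP.
Qed.

(** At or below [t], Phi(C) has only the point [h t]. Hence [a] is above [t], the first element is
    still seen in the trace of [C] on [a], and beyond [t] nothing has changed. *)
Lemma acc_replace_first e h C a : (forall t, h t <= t) ->
  acc (replace_first e h C) a ->
  acc C a /\ replace_first e h C `&` `]-oo, a[ = replace_first e h (C `&` `]-oo, a[).
Proof.
move=> ht; have [[t Ct]|Ce] := first_above_or_le e C; last first.
  by rewrite !replace_first_id// => c [Cc _]; exact: Ce.
rewrite (replace_firstE h Ct) => -[a0 aP].
(* If the first point found below [a] is [h t], a second one strictly above it must exceed [t]. *)
have ta : t < a.
  have [b ba] := (init_neq0 a).1 a0.
  have [c1 [->|[_ tc]] /andP[_ c1a]] := aP b ba; last exact: lt_trans tc c1a.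
  have [c2 [->|[_ tc]] /andP[hc c2a]] := aP _ c1a; last exact: lt_trans tc c2a.
  by rewrite ltxx in hc.
split.
  split=> // b ba; have [|c [->|[Cc _]] /andP[]] := aP (Order.max b t).
  - by rewrite gt_max ba.
  - by rewrite gt_max => /andP[_]; rewrite ltNge ht.
  by rewrite gt_max => /andP[bc _] ca; exists c => //; rewrite bc.
rewrite (replace_firstE h (first_above_restr ta Ct)) in_init.
apply/seteqP; split=> x /=.
  by move=> [[->|[Cx tx]] xa]; [left|right].
by move=> [->|[[Cx xa] tx]]; split=> //; [left|exact: le_lt_trans (ht t) ta|right].
Qed.

Lemma club_replace_first e h C a : (forall t, h t <= t) -> is_limit a ->
  club_in `]-oo, a[ C -> club_in `]-oo, a[ (replace_first e h C).
Proof.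
move=> ht la; rewrite in_init => -[Ca Cu Ccl].
have [[t Ct]|Ce] := first_above_or_le e C; last by rewrite replace_first_id.
have ta : t < a by apply: Ca; case: Ct.
split=> [x|b ba|b ba bacc].
- rewrite (replace_firstE h Ct) => -[->|[/Ca//]]; exact: le_lt_trans (ht t) ta.
(* Unboundedness only gives [sc <= c], so [sc] is taken strictly above [t] to ensure that [c]
   survives the replacement. *)
- have [sc ssc sca] : exists2 s, Order.max b t < s & s < a.
    apply: contrapT => ns; case: la => _; apply; exists (Order.max b t).
    rewrite /is_succ !set_itvE; apply/seteqP; split=> x /= xa.
      by rewrite leNgt; apply/negP => xm; apply: ns; exists x.
    by apply: le_lt_trans xa _; rewrite gt_max ba.
  have [c Cc scc] := Cu sc sca; exists c.
    rewrite (replace_firstE h Ct); right; split=> //.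
    by apply: lt_le_trans scc; apply: le_lt_trans ssc; rewrite le_max lexx orbT.
  by apply: ltW; apply: lt_le_trans scc; apply: le_lt_trans ssc; rewrite le_max lexx.
have [Cb _] := acc_replace_first ht bacc.
have Cb' := Ccl b ba Cb.
rewrite (replace_firstE h Ct); right; split=> //.
move: bacc; rewrite (replace_firstE h Ct) => -[b0 bP].
have [c0 c0b] := (init_neq0 b).1 b0.
have [c1 [->|[_ tc]] /andP[_ c1b]] := bP c0 c0b; last exact: lt_trans tc c1b.
have [c2 [->|[_ tc]] /andP[hc c2b]] := bP _ c1b; last exact: lt_trans tc c2b.
by rewrite ltxx in hc.
Qed.

(** * The choice of [e] and [h], and the new sequence *)

Lemma exists_spaced (u : K -> K) :
  exists f, forall i, i <= f i /\ forall j, j < i -> u (f j) < f i.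
Proof.
(* The default [i] is never taken: by regularity the earlier values of [u] are bounded. *)
pose step i (r : forall j, j < i -> K) : K :=
  xget i [set x | i <= x /\ forall j (ji : j < i), u (r j ji) < x].
pose f := Fix (lt_wf hK) (fun=> K) step.
have fE i : f i = step i (fun j _ => f j).
  apply: (@Fix_eq _ _ (lt_wf hK) (fun=> K) step) => x r r' rr'; congr step.
  by apply: functional_extensionality_dep => y; apply: funext => p.
exists f => i.
suff : [set x | i <= x /\ forall j, j < i -> u (f j) < x] (f i) by [].
rewrite fE; apply: xgetPex.
have [x xP] := init_bounded hK (u \o f) i.
exists (Order.max i x); split=> [|j ji]; first by rewrite le_max lexx.
by rewrite lt_max (xP j ji) orbT.
Qed.

(** The intervals [f i, u (f i)] are pairwise disjoint, and [i <= f i] makes the value [i]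
    regressive on the one indexed by [i]. *)
Lemma exists_regressive_hitting (u : K -> K) :
  exists h, (forall t, h t <= t) /\
    forall i, exists b, forall t, b <= t <= u b -> h t = i.
Proof.
have [f fP] := exists_spaced u.
(* Off the intervals the default [t] keeps [h t <= t]. *)
exists (fun t => xget t [set i | f i <= t <= u (f i)]); split=> [t|i].
  by case: xgetP => // i _ /andP[fit _]; apply: le_trans fit; case: (fP i).
exists (f i) => t fit; apply: xget_unique => // j /andP[fjt tuj].
have /andP[fi ui] := fit.
have [ij|ji|//] := ltgtP i j.
  by have := lt_le_trans ((fP j).2 i ij) fjt; rewrite ltNge ui.
by have := lt_le_trans ((fP i).2 j ji) fi; rewrite ltNge tuj.
Qed.

(** The gap pushes all first elements to [b] or beyond. There are finitely many at each [s], hence a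
    bound below [s], and pressing down makes it a constant [u]. *)
Lemma exists_first_above_interval (CC : K -> set (set K)) (G : set K) :
  square_fin CC -> stat G ->
  exists e, forall b, exists u, stat [set s | [/\ G s, is_limit s &
    forall C, CC s C -> exists2 t, first_above e C t & b <= t <= u]].
Proof.
move=> hCC sG; have [_ _ CClim _ _] := hCC; have [sc scP] := exists_succ hK.
have [e eP] := exists_gap hCC sG; exists e => b; apply: (fodor hK).
apply: statS (statI_closed (fun a => Order.max (sc a) (sc e)) (eP b)).
move=> s [[Gs sP] /closed_under_max[scs [s0 es]]].
have {}es : e < s by have [c /es] := (init_neq0 s).1 s0; apply: lt_trans.
have ls := closed_under_limit scP scs.
have [_ + CCclub] := CClim s ls => /finite_seqP[S CCS].
have CCfirst C : CC s C -> exists2 t, first_above e C t & t < s.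
  move=> CC_C; have [Cs Cu _] := CCclub C CC_C; rewrite in_init in Cs Cu.
  have [[t Ct]|Ce] := first_above_or_le e C; first by exists t => //; apply: Cs; case: Ct.
  have [c Cc] := Cu _ (scs.2 _ es); rewrite leNgt => /negP[].
  exact: le_lt_trans (Ce c Cc) (scP e).
have [|u us uP] := @seq_bounded _ S (first_above e) _ s0.
  move=> C CS; have [|t Ct ts] := CCfirst C; first by rewrite CCS.
  by exists t => // c /(first_above_inj Ct) <-.
exists u => //; split=> // C CC_C; have [t Ct ts] := CCfirst C CC_C.
exists t => //; rewrite (uP C)//; last by move: CC_C; rewrite CCS.
by case: Ct => Ct et _; rewrite (sP C).
Qed.

(** Only limit levels are changed, the others being prescribed. *)
Lemma square_fin_replace_first (CC : K -> set (set K)) e h :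
  square_fin CC -> (forall t, h t <= t) ->
  square_fin (fun a => (if `[< is_limit a >] then replace_first e h else id) @` CC a).
Proof.
move=> hCC ht; have [CC0 CCS CClim CCcoh _] := hCC.
have CCnl a : ~ is_limit a ->
    (if `[< is_limit a >] then replace_first e h else id) @` CC a = CC a.
  by move=> /asboolF ->; rewrite image_id.
split.
- by move=> a a0; rewrite CCnl ?CC0// => -[].
- by move=> b a ba; rewrite CCnl ?(CCS b a)// => -[_]; apply; exists b.
- move=> a la; rewrite (asboolT la); have [[C CC_C] fCC CCclub] := CClim a la; split.
  + by exists (replace_first e h C); exists C.
  + exact: finite_image.
  + by move=> _ [C' /CCclub ? <-]; exact: club_replace_first.
- move=> a _ [C CC_C <-] b ba bacc; have lb := acc_limit bacc; rewrite (asboolT lb).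
  have [la|nla] := pselect (is_limit a).
    move: bacc; rewrite (asboolT la) => /(acc_replace_first ht)[bC ->].
    by exists (C `&` `]-oo, b[) => //; exact: CCcoh CC_C _ (ba) bC.
  exfalso; have [|nz] := pselect (is_zero a).
    by move=> /zero_le/(_ b); rewrite leNgt ba.
  (* At a successor the only member is a singleton, which has no accumulation point. *)
  have [[c ca]|] := pselect (exists c, is_succ c a); last by move=> ?; apply: nla.
  move: CC_C bacc; rewrite (CCS c a ca) (asboolF nla) => -> /= [b0 bP].
  have [x xb] := (init_neq0 b).1 b0; have [_ -> /andP[_ cb]] := bP x xb.
  by have [_ ->] := bP c cb; rewrite ltxx.
move=> [D [Dclub DCC]].
(* A trace of [D] may have several preimages under Phi; all of them are kept, and together they
   cohere. *)
apply: (@no_coherent_system CC (acc D)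
  (fun a => [set C | CC a C /\ replace_first e h C = D `&` `]-oo, a[]) hCC).
- by move=> a; have [s] := acc_unbounded hK Dclub a; exists s.
- by move=> a; exact: acc_limit.
- move=> a aD; split=> [C []//|].
  have := DCC a aD; rewrite (asboolT (acc_limit aD)) => -[C CC_C CD].
  by exists C.
move=> a b C aD bD ba [CC_C CD].
have : acc (replace_first e h C) b by rewrite CD; apply/acc_restr => //; exact: ltW.
move=> /(acc_replace_first ht)[bC Cb]; split; first exact: CCcoh CC_C _ (ba) bC.
by rewrite -Cb CD restr_restr//; exact: ltW.
Qed.

End SquareSequence.

Theorem theorem5p22 (d : Order.disp_t) (K : orderType d)
    (hK : regular_uncountable K)
    (CC : K -> set (set K)) (hCC : square_fin CC)
    (Gamma : set K) (hGamma : stationary Gamma) :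
  exists CC' : K -> set (set K),
    [/\ square_fin CC',
        forall a : K, CC' a #<= CC a &
        forall i : K,
          stationary [set a | Gamma a /\ forall C, CC' a C -> is_min C i]].
Proof.
  have hG := (stationaryE hK Gamma).1 hGamma.
  have [e eP] := exists_first_above_interval hK hCC hG.
  have /choice[u uP] := eP.
  have [h [ht hi]] := exists_regressive_hitting hK u.
  eexists; split; first exact: (square_fin_replace_first hK e hCC ht).
    by move=> a; exact: card_image_le.
  (* Here [b, u b] is an interval on which [h] is constantly [i]. *)
  move=> i; apply/(stationaryE hK); have [b bP] := hi i.
  apply: statS (uP b) => s [Gs ls sP]; split=> // _ [C /sP[t Ct tb] <-].
  rewrite (asboolT ls) (replace_firstE h Ct) (bP t tb); split; first by left.
  move=> x [->//|[_ tx]]; rewrite -(bP t tb); exact: le_trans (ht t) (ltW tx).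
Qed.
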